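(* Let $C\in S^n$ with $C\succeq 0$, $b\in\mathbb{R}^m$, and let $\mathcal{A}:S^n\to\mathbb{R}^m$ be a linear operator, such that both the problem $\min_X\{\langle C,X\rangle : \mathcal{A}X=b,\ X\succeq 0\}$ and its Lagrange dual $\max_y\{b^\top y : C-\mathcal{A}^\top y\succeq 0\}$ have optimal solutions. Consider $$\text{(GP)}\quad \min_{X\in S^n}\{\kappa(X) : \mathcal{A}X=b\},\qquad \text{(GD)}\quad \min_{y\in\mathbb{R}^m}\{\kappa^\circ(\mathcal{A}^\top y) : b^\top y\geq 1\}.$$ Assume that (GD) has an optimal solution, that the optimal value of (GP) is strictly positive, and that strong duality holds, i.e., the product of the optimal values of (GP) and (GD) equals $1$. Then $X^*\in S^n$ and $y^*\in\mathbb{R}^m$ are, respectively, optimal for (GP) and (GD) if and only if $$\mathcal{A}X^*=b,\quad X^*\succeq 0,\quad b^\top y^*=1,\quad\text{and}\quad \langle\mu_{y^*}C-\mathcal{A}^\top y^*,X^*\rangle=0,$$ where $\mu_{y^*}:=\kappa^\circ(\mathcal{A}^\top y^* )$ (the last condition being understood to include $\mu_{y^*}<+\infty$).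
   Context: $S^n$ is the space of real symmetric $n\times n$ matrices with inner product $\langle A,B\rangle=\operatorname{tr}(AB)$; $X\succeq 0$ means $X$ is positive semidefinite. $\mathcal{A}^\top:\mathbb{R}^m\to S^n$ is the adjoint of $\mathcal{A}$. The gauge function $\kappa$ is defined by $\kappa(X)=\langle C,X\rangle$ if $X\succeq 0$ and $\kappa(X)=+\infty$ otherwise. Its polar is $\kappa^\circ(Z)=\inf\{\mu\geq 0 : \mu C-Z\succeq 0\}$ for $Z\in S^n$ (with $\inf\emptyset=+\infty$). *)

(* Defs.v *)
From HB Require Import structures.
From mathcomp Require Import all_boot all_order all_algebra.
From mathcomp Require Import all_classical all_reals ereal.

Set Implicit Arguments.
Unset Strict Implicit.
Unset Printing Implicit Defensive.

Import Order.TTheory GRing.Theory Num.Theory.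
Local Open Scope ring_scope.
Local Open Scope classical_set_scope.

Section SymmetricMatrices.
Context (R : realType) (n : nat).

Definition symmx_pred : {pred 'M[R]_n} := fun M => M \is symmetricmx.

Lemma symmx_predE (M : 'M[R]_n) : (M \in symmx_pred) = (M^T == M).
Proof.
rewrite unfold_in /symmx_pred is_hermitianmxE expr0 scale1r eq_sym.
by rewrite map_mx_id.
Qed.

Lemma symmx_submod_closed : submod_closed symmx_pred.
Proof.
split=> [|a M N]; rewrite !symmx_predE ?trmx0//.
by move=> /eqP hM /eqP hN; rewrite linearP /= hM hN.
Qed.

HB.instance Definition _ :=
  GRing.isSubmodClosed.Build R 'M[R]_n symmx_pred symmx_submod_closed.

Record symmx := SymMx { symmx_val :> 'M[R]_n; _ : symmx_val \in symmx_pred }.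

HB.instance Definition _ := [isSub for symmx_val].
HB.instance Definition _ := [Choice of symmx by <:].
HB.instance Definition _ := [SubChoice_isSubLmodule of symmx by <:].

Lemma trmx_symmx (X : symmx) : X^T = X.
Proof. by apply/eqP; rewrite -symmx_predE; case: X. Qed.

Definition inner (X Y : symmx) : R := \tr (X *m Y).

Definition psd (X : symmx) : Prop :=
  forall v : 'cV[R]_n, 0 <= (v^T *m X *m v) 0 0.

Lemma sym_delta_subproof (i j : 'I_n) :
  2^-1 *: (delta_mx i j + delta_mx j i) \in symmx_pred.
Proof. by rewrite symmx_predE linearZ linearD /= !trmx_delta addrC. Qed.

(* <sym_delta i j, X> = X i j for X in S^n *)
Definition sym_delta (i j : 'I_n) : symmx := SymMx (sym_delta_subproof i j).

Lemma sym_deltaC i j : sym_delta i j = sym_delta j i.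
Proof. by apply: val_inj; rewrite /= addrC. Qed.

End SymmetricMatrices.

Definition dotv (R : realType) (m : nat) (u v : 'cV[R]_m) : R :=
  (u^T *m v) 0 0.

Section Adjoint.
Context (R : realType) (n m : nat) (A : {linear symmx R n -> 'cV[R]_m}).

Lemma adjoint_subproof (y : 'cV[R]_m) :
  \matrix_(i, j) dotv y (A (sym_delta R i j)) \in @symmx_pred R n.
Proof.
by rewrite symmx_predE; apply/eqP/matrixP => i j; rewrite !mxE sym_deltaC.
Qed.

(* The adjoint, by its entries (A^T y)_ij = <sym_delta i j, A^T y>; see
   adjointP and adjoint_unique. *)
Definition adjoint (y : 'cV[R]_m) : symmx R n := SymMx (adjoint_subproof y).

Lemma symmx_sum_delta (X : symmx R n) :
  X = \sum_i \sum_j (X i j) *: sym_delta R i j.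
Proof.
apply: val_inj; rewrite raddf_sum.
have valE i j : val (X i j *: sym_delta R i j) =
    2^-1 *: (X i j *: delta_mx i j + X i j *: delta_mx j i).
  by rewrite /= -scalerDr !scalerA mulrC.
under eq_bigr do rewrite raddf_sum (eq_bigr _ (fun j _ => valE _ j)).
under eq_bigr do rewrite -scaler_sumr big_split /=.
rewrite -scaler_sumr big_split /= -matrix_sum_delta exchange_big /=.
have -> : \sum_j \sum_i X i j *: delta_mx j i = X :> 'M[R]_n.
  rewrite [RHS]matrix_sum_delta; apply: eq_bigr => j _; apply: eq_bigr => i _.
  by rewrite -{1}(trmx_symmx X) mxE.
by rewrite -mulr2n -scaler_nat scalerA mulVf ?scale1r// pnatr_eq0.
Qed.

Lemma adjointP (y : 'cV[R]_m) (X : symmx R n) :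
  inner (adjoint y) X = dotv y (A X).
Proof.
rewrite {2}(symmx_sum_delta X) linear_sum /= /dotv mulmx_sumr summxE.
rewrite /inner /mxtrace; apply: eq_bigr => i _.
rewrite mxE linear_sum /= mulmx_sumr summxE; apply: eq_bigr => j _.
rewrite linearZ /= -scalemxAr !mxE mulrC.
by rewrite -{1}(trmx_symmx X) mxE /dotv mxE.
Qed.

Lemma adjoint_unique (B : 'cV[R]_m -> symmx R n) :
  (forall y X, inner (B y) X = dotv y (A X)) -> B =1 adjoint.
Proof.
move=> hB y; pose D := B y - adjoint y.
have hD : inner D D = 0.
  have -> : inner D D = inner (B y) D - inner (adjoint y) D.
    by rewrite /inner -raddfB -mulmxBl.
  by rewrite hB adjointP subrr.
apply/eqP; rewrite -subr_eq0 -/D; apply/eqP/val_inj => /=.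
apply/matrixP => i j; rewrite [RHS]mxE; apply/eqP; rewrite -[_ i j]/(D i j).
have hs : \sum_k \sum_l (D k l) ^+ 2 = 0.
  rewrite -[RHS]hD /inner /mxtrace; apply: eq_bigr => k _.
  rewrite mxE; apply: eq_bigr => l _.
  have -> : D l k = D k l by rewrite -[in LHS](trmx_symmx D) [LHS]mxE.
  by rewrite expr2.
have hi : \sum_l (D i l) ^+ 2 = 0.
  apply: (psumr_eq0P _ hs) => // k _.
  by apply: sumr_ge0 => l _; exact: sqr_ge0.
by rewrite -sqrf_eq0 (psumr_eq0P _ hi)// => l _; exact: sqr_ge0.
Qed.

End Adjoint.

Section Optimality.
Context (d : Order.disp_t) (U : porderType d) (T : Type).

Definition minimizer (f : T -> U) (F : set T) (x : T) : Prop :=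
  F x /\ forall z, F z -> (f x <= f z)%O.

Definition maximizer (f : T -> U) (F : set T) (x : T) : Prop :=
  F x /\ forall z, F z -> (f z <= f x)%O.

End Optimality.

Section Gauge.
Context (R : realType) (n : nat) (C : symmx R n).

Definition kappa (X : symmx R n) : \bar R :=
  if `[< psd X >] then (inner C X)%:E else +oo%E.

(* ereal_inf set0 = +oo *)
Definition kappa_polar (Z : symmx R n) : \bar R :=
  ereal_inf [set mu%:E | mu in [set mu : R | 0 <= mu /\ psd (mu *: C - Z)]].

Context (m : nat) (A : {linear symmx R n -> 'cV[R]_m}) (b : 'cV[R]_m).

Definition gp_feasible : set (symmx R n) := [set X | A X = b].
Definition gd_feasible : set 'cV[R]_m := [set y | 1 <= dotv b y].

Definition gd_obj (y : 'cV[R]_m) : \bar R := kappa_polar (adjoint A y).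

Definition gp_value : \bar R := ereal_inf (kappa @` gp_feasible).
Definition gd_value : \bar R := ereal_inf (gd_obj @` gd_feasible).

Definition gp_optimal : symmx R n -> Prop := minimizer kappa gp_feasible.
Definition gd_optimal : 'cV[R]_m -> Prop := minimizer gd_obj gd_feasible.

End Gauge.

(* Main.v *)
Require Import Defs.
From mathcomp Require Import all_boot all_order all_algebra.
From mathcomp Require Import all_classical all_reals ereal.
From mathcomp Require Import ring lra.
Import Order.TTheory GRing.Theory Num.Theory.
Local Open Scope ring_scope.
Local Open Scope classical_set_scope.

(** For [X] psd and [mu C - A^T y] psd, self-duality of the psd cone gives
    [b^T y = <A^T y, X> <= mu <C, X>].  The infimum defining the polar gauge is
    attained, so this applies with [mu = kappa_polar C (A^T y)]; since the
    optimal values are inverse to each other, both [b^T y >= 1] and this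
    inequality are tight exactly at optimal pairs. *)

Section PsdForm.
Set Implicit Arguments.
Unset Strict Implicit.
Context {R : realType} {n : nat}.
Implicit Types (P Q X Y Z : symmx R n) (u v : 'cV[R]_n).

Definition bform P u v : R := (u^T *m P *m v) 0 0.

Lemma bformBl P Q u v : bform (P - Q) u v = bform P u v - bform Q u v.
Proof. by rewrite /bform mulmxBr mulmxBl [LHS]mxE [X in _ + X]mxE. Qed.

Lemma bformZl (a : R) P u v : bform (a *: P) u v = a * bform P u v.
Proof. by rewrite /bform -scalemxAr -scalemxAl [LHS]mxE. Qed.

Lemma bformC P u v : bform P u v = bform P v u.
Proof.
rewrite /bform; have -> : u^T *m P *m v = (v^T *m P *m u)^T.
  by rewrite !trmx_mul trmxK trmx_symmx mulmxA.
by rewrite mxE.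
Qed.

Lemma bformDZ P u v (t : R) :
  bform P (u + t *: v) (u + t *: v) =
  bform P u u + 2 * t * bform P u v + t ^+ 2 * bform P v v.
Proof.
have -> : bform P (u + t *: v) (u + t *: v) =
    bform P u u + t * bform P u v + t * bform P v u + t ^+ 2 * bform P v v.
  have trE : (u + t *: v)^T = u^T + t *: v^T by rewrite linearD linearZ.
  rewrite /bform trE !(mulmxDl, mulmxDr).
  by rewrite -!scalemxAl -!scalemxAr !mxE; ring.
by rewrite (bformC P v u); ring.
Qed.

Lemma bform_delta P (i j : 'I_n) :
  bform P (delta_mx i 0) (delta_mx j 0) = P i j.
Proof. by rewrite /bform trmx_delta -rowE -colE !mxE. Qed.

(** The quadratic [t -> bform P (u + t *: v) (u + t *: v)] is nonnegative everywhere, which bounds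
    its discriminant. *)
Lemma psd_cauchy_schwarz P u v :
  psd P -> bform P u v ^+ 2 <= bform P u u * bform P v v.
Proof.
move=> hP; set a := bform P u u; set b := bform P u v; set c := bform P v v.
have q t : 0 <= a + 2 * t * b + t ^+ 2 * c by rewrite -bformDZ; exact: hP.
have c0 : 0 <= c by exact: hP.
have a0 : 0 <= a by exact: hP.
have [c_eq0|c_neq0] := eqVneq c 0.
  have [-> | b_neq0] := eqVneq b 0; first by rewrite expr0n mulr_ge0.
  (* With [c = 0] the quadratic is affine in [t] with slope [2 * b]; at this [t] it would equal
     [-1]. *)
  have := q (- (a + 1) / (2 * b)).
  rewrite c_eq0 mulr0 addr0.
  have -> : a + 2 * (- (a + 1) / (2 * b)) * b = -1 by field.
  lra.
(* The point [- b / c] is the minimiser of the quadratic. *)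
have := q (- b / c).
have -> : a + 2 * (- b / c) * b + (- b / c) ^+ 2 * c = (a * c - b ^+ 2) / c.
  by field.
by rewrite pmulr_lge0 ?subr_ge0// invr_gt0 lt_def c_neq0.
Qed.

Lemma innerDl X Y Z : inner (X + Y) Z = inner X Z + inner Y Z.
Proof. by rewrite /inner mulmxDl mxtraceD. Qed.

Lemma innerBl X Y Z : inner (X - Y) Z = inner X Z - inner Y Z.
Proof. by rewrite /inner mulmxBl raddfB. Qed.

Lemma innerZl (a : R) X Y : inner (a *: X) Y = a * inner X Y.
Proof. by rewrite /inner -scalemxAl mxtraceZ. Qed.

Lemma outer_subproof u : u *m u^T \in @symmx_pred R n.
Proof. by rewrite symmx_predE trmx_mul trmxK. Qed.

Definition outer u : symmx R n := SymMx (outer_subproof u).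

Lemma inner_outer u Q : inner (outer u) Q = bform Q u u.
Proof.
by rewrite /inner /= -mulmxA mxtrace_mulC /mxtrace big_ord1.
Qed.

Lemma bform_outer w u v : bform (outer w) u v = (u^T *m w) 0 0 * (w^T *m v) 0 0.
Proof. by rewrite /bform /= mulmxA -mulmxA mxE big_ord1. Qed.

(* One step of the [LDL^T] factorisation: subtracting the rank-one matrix
   built from column [i] clears the [i]-th diagonal entry. *)
Definition pivot P (i : 'I_n) : symmx R n :=
  P - (P i i)^-1 *: outer (P *m delta_mx i 0).

Lemma bform_pivot P i v :
  bform (pivot P i) v v =
  bform P v v - (P i i)^-1 * bform P v (delta_mx i 0) ^+ 2.
Proof.
rewrite bformBl bformZl bform_outer trmx_mul trmx_symmx mulmxA.
by rewrite -/(bform P v _) -/(bform P _ v) (bformC P (delta_mx _ _)) expr2.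
Qed.

Lemma psd_diag_ge0 P i : psd P -> 0 <= P i i.
Proof. by move=> hP; rewrite -bform_delta; exact: hP. Qed.

(** The subtracted term is at most [bform P v v] by Cauchy-Schwarz against the [i]-th basis
    vector. *)
Lemma psd_pivot P i : psd P -> P i i != 0 -> psd (pivot P i).
Proof.
move=> hP Pii v; rewrite -/(bform _ v v) bform_pivot subr_ge0.
have Pi0 : 0 < P i i by rewrite lt_def Pii psd_diag_ge0.
rewrite mulrC ler_pdivrMr//.
by rewrite -(bform_delta P i i); exact: psd_cauchy_schwarz.
Qed.

Lemma pivot_diag_le P i j : psd P -> pivot P i j j <= P j j.
Proof.
move=> hP; rewrite -!bform_delta bform_pivot lerBlDr lerDl.
by rewrite mulr_ge0 ?sqr_ge0// invr_ge0 psd_diag_ge0.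
Qed.

Lemma pivot_diag0 P i : P i i != 0 -> pivot P i i i = 0.
Proof. by move=> Pii; rewrite -bform_delta bform_pivot bform_delta; field. Qed.

(** Induction on the number of nonzero diagonal entries of [P]: a pivot splits off a nonnegative
    multiple of some [outer w], whose inner product with [Q] is [bform Q w w]. *)
Lemma psd_inner_ge0 P Q : psd P -> psd Q -> 0 <= inner P Q.
Proof.
move=> hP hQ.
have [k] := ubnP #|[set i | P i i != 0]%SET|.
elim: k P hP => // k IH P hP.
have [i Pii|P0] := pickP (fun i => P i i != 0); last first.
  (* A zero diagonal forces zero entries, as [P i j ^+ 2 <= P i i * P j j]. *)
  have -> : P = 0.
    apply/val_inj/matrixP => i j; rewrite [RHS]mxE; apply/eqP.
    have := psd_cauchy_schwarz (delta_mx i 0) (delta_mx j 0) hP.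
    have /negbFE/eqP Pi := P0 i.
    rewrite !bform_delta Pi mul0r => hle; rewrite -sqrf_eq0 eq_le.
    by rewrite sqr_ge0 andbT.
  by rewrite /inner mul0mx mxtrace0.
rewrite ltnS => cardP.
have -> : P = pivot P i + (P i i)^-1 *: outer (P *m delta_mx i 0).
  by rewrite subrK.
rewrite innerDl innerZl inner_outer addr_ge0//; last first.
  by rewrite mulr_ge0 ?invr_ge0 ?psd_diag_ge0//; exact: hQ.
apply: IH; first exact: psd_pivot.
apply: leq_trans cardP; apply: proper_card; apply/properP; split.
  (* A zero diagonal entry stays zero, squeezed between psd-ness of the pivot and [pivot_diag_le];
     entry [i] makes the inclusion strict. *)
  apply/fintype.subsetP => j; rewrite !inE; apply: contraNneq => Pj0.
  rewrite eq_le psd_diag_ge0 ?andbT; last exact: psd_pivot.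
  by rewrite -[leRHS]Pj0 pivot_diag_le.
by exists i; rewrite inE ?Pii// pivot_diag0// eqxx.
Qed.

End PsdForm.

Section PolarGauge.
Set Implicit Arguments.
Unset Strict Implicit.
Context {R : realType} {n : nat} (C : symmx R n).

Lemma kappa_psd X : psd X -> kappa C X = (inner C X)%:E.
Proof. by rewrite /kappa => hX; case: asboolP. Qed.

Lemma kappa_polar_ge0 Z : (0 <= kappa_polar C Z)%E.
Proof. by apply: le_ereal_inf_tmp => _ [mu [mu0 _] <-]; rewrite lee_fin. Qed.

(** For each fixed [v] the constraint on [mu] is a closed half-line condition, monotone in [mu]
    because [C] is psd, so it passes to the infimum. *)
Lemma kappa_polar_attained Z :
  psd C -> (kappa_polar C Z < +oo)%E -> psd (fine (kappa_polar C Z) *: C - Z).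
Proof.
move=> C_psd fin_mu v.
have kE : kappa_polar C Z = (fine (kappa_polar C Z))%:E.
  by rewrite fineK// ge0_fin_numE// kappa_polar_ge0.
set mu := fine _ in kE *.
have formE t : bform (t *: C - Z) v v = t * bform C v v - bform Z v v.
  by rewrite bformBl bformZl.
rewrite -/(bform _ v v) formE subr_ge0; set c := bform C v v.
have c0 : 0 <= c by exact: C_psd.
apply/ler_addgt0Pr => e e0.
(* The slack is divided by [c + 1] since [c] may vanish; multiplied by [c] it stays below [e]. *)
have : (kappa_polar C Z < (mu + e / (c + 1))%:E)%E.
  by rewrite kE lte_fin ltrDl divr_gt0// ltr_wpDl.
move=> /ereal_inf_lt[_ [t [_ ht] <-]]; rewrite lte_fin => tmu.
have := ht v; rewrite -/(bform _ v v) formE subr_ge0 => /le_trans; apply.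
apply: (le_trans (ler_wpM2r c0 (ltW tmu))).
rewrite mulrDl lerD2l -mulrA ler_piMr ?(ltW e0)//.
by rewrite mulrC ler_pdivrMr ?ltr_wpDl// mul1r lerDl.
Qed.

End PolarGauge.

Section ExtendedValues.
Set Implicit Arguments.
Unset Strict Implicit.

Context {R : realType} {T : Type}.
Implicit Types (f : T -> \bar R) (F : set T).

Lemma ge_ereal_inf_image f F x :
  F x -> (ereal_inf (f @` F) <= f x)%E.
Proof. by move=> Fx; apply: ge_ereal_inf; exists (f x) => //; exists x. Qed.

Lemma minimizer_inf f F x :
  minimizer f F x -> f x = ereal_inf (f @` F).
Proof.
move=> [Fx fx]; apply/eqP; rewrite eq_le; apply/andP; split.
  by apply: le_ereal_inf_tmp => _ [z Fz <-]; exact: fx.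
exact: ge_ereal_inf_image.
Qed.

Lemma inf_minimizer f F x :
  F x -> f x = ereal_inf (f @` F) -> minimizer f F x.
Proof.
by move=> Fx fE; split=> // z Fz; rewrite fE; exact: ge_ereal_inf_image.
Qed.

Lemma dotvC m (u v : 'cV[R]_m) : dotv u v = dotv v u.
Proof. by rewrite /dotv !mxE; apply: eq_bigr => i _; rewrite !mxE mulrC. Qed.

Lemma mule_eq1_fin (p : R) (d : \bar R) :
  0 < p -> (p%:E * d = 1)%E -> d = (p^-1)%:E.
Proof.
move=> p0; case: d => [d | |]; last 2 first.
- by rewrite gt0_muley ?lte_fin.
- by rewrite gt0_muleNy ?lte_fin.
move=> -[pd]; congr (_%:E).
by rewrite -[RHS]mulr1 -pd mulKf// gt_eqF.
Qed.

End ExtendedValues.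

Theorem theorem4p3 (R : realType) (n m : nat) (C : symmx R n) (b : 'cV[R]_m)
    (A : {linear symmx R n -> 'cV[R]_m})
    (C_psd : psd C)
    (primal_solvable :
       exists X, minimizer (inner C) [set X | A X = b /\ psd X] X)
    (dual_solvable :
       exists y, maximizer (dotv b) [set y | psd (C - adjoint A y)] y)
    (gd_solvable : exists y, gd_optimal C A b y)
    (gp_value_gt0 : (0 < gp_value C A b)%E)
    (strong_duality : (gp_value C A b * gd_value C A b = 1)%E)
    (X : symmx R n) (y : 'cV[R]_m) :
  let mu := kappa_polar C (adjoint A y) in
  gp_optimal C A b X /\ gd_optimal C A b y <->
  [/\ A X = b, psd X, dotv b y = 1,
      (mu < +oo)%E & inner (fine mu *: C - adjoint A y) X = 0].
Proof.
move=> mu.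
(* Positivity excludes [-oo], and a primal solution has finite [kappa]. *)
have [p pE] : exists p, gp_value C A b = p%:E.
  exists (fine (gp_value C A b)); rewrite fineK// ge0_fin_numE ?ltW//.
  have [X0 [[AX0 X0psd] _]] := primal_solvable.
  apply: (@le_lt_trans _ _ (kappa C X0)); last by rewrite kappa_psd ?ltry.
  exact: ge_ereal_inf_image.
have p0 : 0 < p by rewrite -lte_fin -pE.
have dE : gd_value C A b = (p^-1)%:E.
  by apply: mule_eq1_fin => //; rewrite -pE.
have innerE : A X = b ->
    inner (fine mu *: C - adjoint A y) X = fine mu * inner C X - dotv b y.
  by move=> AX; rewrite innerBl innerZl adjointP AX dotvC.
split=> [[Xopt yopt]|[AX Xpsd by1 muy]].
  have kX := minimizer_inf Xopt; have ky := minimizer_inf yopt.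
  case: Xopt => AX _; case: yopt => by1 _.
  have AXb : A X = b := AX.
  have muE : mu = (p^-1)%:E by rewrite -dE.
  have muy : (mu < +oo)%E by rewrite muE ltry.
  have kXp : kappa C X = p%:E by rewrite -pE.
  have Xpsd : psd X by move: kXp; rewrite /kappa; case: asboolP.
  have CX : inner C X = p by move: kXp; rewrite kappa_psd// => -[].
  (* This gives [dotv b y <= fine mu * inner C X = p^-1 * p = 1], the converse of feasibility. *)
  have := psd_inner_ge0 (kappa_polar_attained C_psd muy) Xpsd.
  rewrite -/mu innerE// CX muE /= mulVf ?gt_eqF// subr_ge0 => by1'.
  have byE : dotv b y = 1 by apply/eqP; rewrite eq_le by1' by1.
  by split=> //; rewrite ?ltry// byE subrr.
rewrite innerE// by1 => /eqP; rewrite subr_eq0 => /eqP muCX.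
(* Finiteness of [mu] matters here: [fine] sends [+oo] to [0]. *)
have muE : mu = (fine mu)%:E by rewrite fineK// ge0_fin_numE// kappa_polar_ge0.
have gdy : gd_feasible b y by rewrite /gd_feasible /= by1.
have pX : p <= inner C X.
  by rewrite -lee_fin -pE -kappa_psd//; exact: ge_ereal_inf_image.
have dy : p^-1 <= fine mu.
  by rewrite -lee_fin -dE -muE; exact: (ge_ereal_inf_image (gd_obj C A) gdy).
have CX0 : 0 < inner C X := lt_le_trans p0 pX.
have muV : fine mu = (inner C X)^-1.
  by rewrite -[LHS](mulfK (lt0r_neq0 CX0)) muCX mul1r.
(* Since [fine mu] is the inverse of [inner C X], the bound [dy] inverts to [inner C X <= p], so
   both value bounds are tight. *)
have CXp : inner C X = p.
  by apply/eqP; rewrite eq_le pX andbT -lef_pV2 ?posrE// -muV.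
split; apply: inf_minimizer => //.
  by rewrite kappa_psd// CXp -pE.
by rewrite -[LHS]/mu muE muV CXp -dE.
Qed.
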